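(* Let $\mathbf{k}$ be a field of characteristic $0$ and suppose $n\ge 5$. Let $V_1,\dots,V_n$ be vector spaces over $\mathbf{k}$, let $f_6$ and $f_{16}$ denote minimal generators (of degrees $6$ and $16$ respectively) of the ideal of $\sigma_5((\mathbf{P}^1)^{\times 5})$, and let $F_6$ and $F_{16}$, respectively, denote the natural liftings of $f_6$ and $f_{16}$ to $\mathbf{k}[V_1\otimes\cdots\otimes V_n]$. Let $X$ be the fifth secant variety of $\mathbf{P}(V_1)\times\cdots\times\mathbf{P}(V_n)\subset\mathbf{P}(V_1\otimes\cdots\otimes V_n)$. Then the linear span of the $\mathbf{GL}(V_1)\times\cdots\times\mathbf{GL}(V_n)\rtimes\Sigma_n$-orbits of $F_6$ and $F_{16}$ consists of equations that vanish on $X$.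
   Context: The inclusion $\mathbf{P}(V_1)\times\cdots\times\mathbf{P}(V_n)\subset\mathbf{P}(V_1\otimes\cdots\otimes V_n)$ is the Segre embedding $([v_1],\dots,[v_n])\mapsto[v_1\otimes\cdots\otimes v_n]$. The fifth secant variety of a subvariety of projective space is the Zariski closure of the union of the linear spans of $5$-tuples of its points. $\sigma_5((\mathbf{P}^1)^{\times 5})$ is the fifth secant variety of the Segre product of five projective lines in $\mathbf{P}((\mathbf{k}^2)^{\otimes 5})$; its affine cone is a complete intersection of two equations, $f_6$ of degree $6$ and $f_{16}$ of degree $16$. $\mathbf{k}[V_1\otimes\cdots\otimes V_n]$ denotes the ring of polynomials on $V_1\otimes\cdots\otimes V_n$. The natural liftings are those given by flattening and inheritance. Flattening handles an increase in the number of factors (grouping the $n$ tensor factors so as to view $V_1\otimes\cdots\otimes V_n$ as a tensor product of five vector spaces). Inheritance handles an increase in the dimensions of the factors: as representations of $\mathbf{GL}_2^{\times 5}$, $f_6$ and $f_{16}$ correspond to the five-fold products of Schur functors $\mathbf{S}_{3,3}\boxtimes\cdots\boxtimes\mathbf{S}_{3,3}$ and $\mathbf{S}_{8,8}\boxtimes\cdots\boxtimes\mathbf{S}_{8,8}$, and these can be evaluated on larger vector spaces. The groups $\mathbf{GL}(V_i)$ act on the respective tensor factors, and the symmetric group $\Sigma_n$ permutes the $n$ factors. The star on the label indicates that the result relies on probabilistic symbolic computations and numerical computations, so that technically it holds only with high probability or up to numerical precision. *)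

(* Defs.v *)
From HB Require Import structures.
From mathcomp Require Import all_boot all_order all_algebra all_fingroup.
From mathcomp Require Export mpoly.

Set Implicit Arguments.
Unset Strict Implicit.
Unset Printing Implicit Defensive.

Import GRing.Theory.
Local Open Scope ring_scope.

(* Every finite-dimensional vector space is taken with a basis: V_i is
   'rV[k]_(d i), and V_1 (x) ... (x) V_n has the basis
   e_I = e_(I 1) (x) ... (x) e_(I n), indexed by the multi-indices I. *)
Definition tidx (n : nat) (d : 'I_n -> nat) : finType :=
  {dffun forall i : 'I_n, 'I_(d i)}.

Definition tensor (k : fieldType) (n : nat) (d : 'I_n -> nat) : vectType k :=
  {ffun tidx d -> k^o}.

(* The coordinate ring k[V_1 (x) ... (x) V_n]: the variable 'X_(enum_rank I)
   is the coordinate function t |-> t I. *)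
Definition tpoly (k : fieldType) (n : nat) (d : 'I_n -> nat) :=
  {mpoly k[#|tidx d|]}.

Definition tvar (k : fieldType) (n : nat) (d : 'I_n -> nat) (I : tidx d) :
  tpoly k d := 'X_(enum_rank I).

Definition peval (k : fieldType) (n : nat) (d : 'I_n -> nat)
    (p : tpoly k d) (t : tensor k d) : k :=
  p.@[fun x => t (enum_val x)].

(* The substitution tvar I |-> X I. *)
Definition psubst (k : fieldType) (n m : nat) (d : 'I_n -> nat)
    (e : 'I_m -> nat) (X : tidx d -> tpoly k e) (p : tpoly k d) : tpoly k e :=
  p \mPo [tuple X (enum_val x) | x < #|tidx d|].

(* v_1 (x) ... (x) v_n *)
Definition pure (k : fieldType) (n : nat) (d : 'I_n -> nat)
    (v : forall i, 'rV[k]_(d i)) : tensor k d :=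
  [ffun I : tidx d => \prod_i v i ord0 (I i)].

(* A_1 (x) ... (x) A_n, where A_i is the linear map v |-> v *m A i. *)
Definition tmap (k : fieldType) (n : nat) (d e : 'I_n -> nat)
    (A : forall i, 'M[k]_(d i, e i)) (t : tensor k d) : tensor k e :=
  [ffun J : tidx e => \sum_(I : tidx d) t I * \prod_i A i (I i) (J i)].

(* The pullback p o (A_1 (x) ... (x) A_n). *)
Definition pull (k : fieldType) (n : nat) (d e : 'I_n -> nat)
    (A : forall i, 'M[k]_(d i, e i)) (p : tpoly k e) : tpoly k d :=
  psubst (fun J : tidx e =>
    \sum_(I : tidx d) (\prod_i A i (I i) (J i)) *: tvar k I) p.

Definition lspan (k : fieldType) (V : lmodType k) (S : V -> Prop) (x : V) :
    Prop :=
  exists (m : nat) (c : 'I_m -> k) (s : 'I_m -> V),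
    (forall i, S (s i)) /\ x = \sum_i c i *: s i.

(* Subsets of P(V_1 (x) ... (x) V_n) are given by the nonzero tensors that
   represent their points. *)
Definition segre (k : fieldType) (n : nat) (d : 'I_n -> nat)
    (t : tensor k d) : Prop :=
  exists v : forall i, 'rV[k]_(d i), (forall i, v i != 0) /\ t = pure v.

Definition zariski_closure (k : fieldType) (n : nat) (d : 'I_n -> nat)
    (Y : tensor k d -> Prop) (t : tensor k d) : Prop :=
  t != 0 /\
  forall (N : nat) (p : tpoly k d), p \is N.-homog ->
    (forall y, Y y -> peval p y = 0) -> peval p t = 0.

Definition secant_variety (r : nat) (k : fieldType) (n : nat)
    (d : 'I_n -> nat) (S : tensor k d -> Prop) : tensor k d -> Prop :=
  zariski_closure (fun t =>
    t != 0 /\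
    exists x : r.-tuple (tensor k d),
      (forall j, S (tnth x j)) /\ t \in <<x>>%VS).

(* For projective X, the p vanishing at all representatives of all points form
   the homogeneous ideal of X, as k is infinite. *)
Definition vanishes_on (k : fieldType) (n : nat) (d : 'I_n -> nat)
    (X : tensor k d -> Prop) (p : tpoly k d) : Prop :=
  forall t, X t -> peval p t = 0.

Definition in_ideal (R : comNzRingType) (fs : seq R) (p : R) : Prop :=
  exists a : 'I_(size fs) -> R, p = \sum_i a i * fs`_i.

Definition minimal_generators (R : comNzRingType) (J : R -> Prop)
    (fs : seq R) : Prop :=
  (forall p, J p <-> in_ideal fs p) /\
  (forall i, (i < size fs)%N -> ~ in_ideal (take i fs ++ drop i.+1 fs) fs`_i).

Definition tpower (k : fieldType) (N m : nat) : vectType k :=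
  tensor k (fun _ : 'I_N => m).

(* (v_1 (x) ... (x) v_N) . s = v_(s 1) (x) ... (x) v_(s N) *)
Definition place_perm (k : fieldType) (N m : nat) (s : 'S_N)
    (t : tpower k N m) : tpower k N m :=
  [ffun I : tidx (fun _ : 'I_N => m) =>
     t [ffun j => I ((s^-1)%g j)]].

(* The standard tableau of shape la numbers the boxes row by row: box j lies
   in row reshape_index la j and column reshape_offset la j. *)
Definition row_stab (la : seq nat) : {set 'S_(sumn la)} :=
  [set s : 'S_(sumn la) |
    [forall j : 'I_(sumn la), reshape_index la (s j) == reshape_index la j]].

Definition col_stab (la : seq nat) : {set 'S_(sumn la)} :=
  [set s : 'S_(sumn la) |
    [forall j : 'I_(sumn la), reshape_offset la (s j) == reshape_offset la j]].

(* Right action of the Young symmetrizer a_la b_la: symmetrize along the rows,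
   then antisymmetrize along the columns. *)
Definition young_symmetrizer (k : fieldType) (la : seq nat) (m : nat)
    (t : tpower k (sumn la) m) : tpower k (sumn la) m :=
  \sum_(q in col_stab la)
    (-1) ^+ odd_perm q *: place_perm q (\sum_(p in row_stab la) place_perm p t).

(* The Schur functor S_la at k^m, as a subspace of (k^m)^{(x) |la|}. *)
Definition schur (k : fieldType) (la : seq nat) (m : nat)
    (t : tpower k (sumn la) m) : Prop :=
  exists u, t = young_symmetrizer u.

(* A natural transformation
     S_la(B_1) [x] ... [x] S_la(B_r) --> Sym^|la| (B_1 (x) ... (x) B_r)
   of functors of r vector spaces, B_i = k^(m i).  A linear map out of the
   external product is given as a multilinear map.  Since B_i is the dual of
   V_i, the target is the space of forms of degree |la| on V_1 (x) ... (x) V_r,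
   and h i : B_i -> B'_i acts on it by the pullback along the transposes
   V'_i -> V_i. *)
Definition schur_transformation (k : fieldType) (r : nat) (la : seq nat)
    (Phi : forall m : 'I_r -> nat,
             (forall i, tpower k (sumn la) (m i)) -> tpoly k m) : Prop :=
  [/\ forall m s, (forall i, schur (s i)) -> Phi m s \is (sumn la).-homog,
      forall (m : 'I_r -> nat) (s : forall i, tpower k (sumn la) (m i))
             (i : 'I_r) (a : k) (u v : tpower k (sumn la) (m i)),
        (forall j, schur (s j)) -> schur u -> schur v ->
        Phi m (dfwith s (a *: u + v)) =
          a *: Phi m (dfwith s u) + Phi m (dfwith s v)
    & forall (m m' : 'I_r -> nat) (h : forall i, 'M[k]_(m i, m' i))
             (s : forall i, tpower k (sumn la) (m i)),
        (forall i, schur (s i)) ->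
        Phi m' (fun i => tmap (fun _ => h i) (s i)) =
          pull (fun i => (h i)^T) (Phi m s)].

Definition schur_image (k : fieldType) (r : nat) (la : seq nat)
    (Phi : forall m : 'I_r -> nat,
             (forall i, tpower k (sumn la) (m i)) -> tpoly k m)
    (m : 'I_r -> nat) : tpoly k m -> Prop :=
  lspan (fun p => exists s : forall i, tpower k (sumn la) (m i),
                    (forall i, schur (s i)) /\ p = Phi m s).

(* The polynomial f on (k^2)^{(x) r} spans a copy of S_la [x] ... [x] S_la,
   and F lies in the evaluation of this copy on the spaces k^(m i). *)
Definition inherits (k : fieldType) (r : nat) (la : seq nat)
    (f : tpoly k (fun _ : 'I_r => 2%N)) (m : 'I_r -> nat) (F : tpoly k m) :
    Prop :=
  exists Phi : forall m : 'I_r -> nat,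
                 (forall i, tpower k (sumn la) (m i)) -> tpoly k m,
    [/\ schur_transformation Phi,
        forall p, schur_image Phi p <-> exists c : k, p = c *: f
      & schur_image Phi F].

(* The factor i is put in the group pi i; the group a gives the vector space
   W_a = (x)_(i | pi i = a) V_i, whose basis vectors are numbered by enum_rank. *)
Definition group_idx (n r : nat) (d : 'I_n -> nat) (pi : 'I_n -> 'I_r)
    (a : 'I_r) : finType :=
  {dffun forall i : {i : 'I_n | pi i == a}, 'I_(d (val i))}.

Definition group_dim (n r : nat) (d : 'I_n -> nat) (pi : 'I_n -> 'I_r)
    (a : 'I_r) : nat := #|group_idx d pi a|.

(* The identification of the bases of W_1 (x) ... (x) W_r and of
   V_1 (x) ... (x) V_n. *)
Definition ungroup_idx (n r : nat) (d : 'I_n -> nat) (pi : 'I_n -> 'I_r)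
    (K : tidx (group_dim d pi)) : tidx d :=
  [ffun i => (enum_val (K (pi i)) : group_idx d pi (pi i))
               (exist (fun j => pi j == pi i) i (eqxx (pi i)))].

Definition flatten_poly (k : fieldType) (n r : nat) (d : 'I_n -> nat)
    (pi : 'I_n -> 'I_r) (G : tpoly k (group_dim d pi)) : tpoly k d :=
  psubst (fun K => tvar k (ungroup_idx K)) G.

(* F is a natural lifting of f, for some grouping of the n factors into r
   (nonempty) groups. *)
Definition natural_lifting (k : fieldType) (n r : nat) (la : seq nat)
    (f : tpoly k (fun _ : 'I_r => 2%N)) (d : 'I_n -> nat) (F : tpoly k d) :
    Prop :=
  exists pi : 'I_n -> 'I_r,
    (forall a, exists i, pi i = a) /\
    exists G : tpoly k (group_dim d pi),
      inherits la f G /\ F = flatten_poly G.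

(* (g . p)(t) = p (g^-1 t) *)
Definition gl_act (k : fieldType) (n : nat) (d : 'I_n -> nat)
    (g : forall i, 'M[k]_(d i)) (p : tpoly k d) : tpoly k d :=
  pull (fun i => invmx (g i)) p.

(* s : v_1 (x) ... (x) v_n |-> v_(s 1) (x) ... (x) v_(s n) carries
   V_1 (x) ... (x) V_n to V'_1 (x) ... (x) V'_n with V'_i = V_(s i), and
   carries the polynomial p to (s . p)(t) = p (s^-1 t). *)
Definition perm_act (k : fieldType) (n : nat) (d e : 'I_n -> nat) (s : 'S_n)
    (de : forall i, d (s i) = e i) (p : tpoly k d) : tpoly k e :=
  psubst (fun I : tidx d =>
    tvar k ([ffun i => cast_ord (de i) (I (s i))] : tidx e)) p.

(* Since a permutation of factors of different dimensions changes the space,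
   the orbit of a polynomial p on the tensors of format d has elements in each
   format e that is a rearrangement of d; for e = d these are the elements in
   k[V_1 (x) ... (x) V_n]. *)
Definition orbit_elt (k : fieldType) (n : nat) (d e : 'I_n -> nat)
    (p : tpoly k d) (q : tpoly k e) : Prop :=
  exists (s : 'S_n) (de : forall i, d (s i) = e i)
         (g : forall i, 'M[k]_(e i)),
    (forall i, g i \in unitmx) /\ q = gl_act g (perm_act de p).

(* Main.v *)
(* In characteristic 0, polarization shows that S_la(k^m) is spanned by the
   images, under linear maps from a space whose dimension is the number of rows
   of la, of one single tensor.  For two-row shapes that space is k^2, so by
   naturality every element of the copy of S_(c,c) [x] ... [x] S_(c,c) over
   larger spaces is a combination of pullbacks of f along tensor products of
   linear maps V_i -> k^2.  Such maps, the regrouping of factors, the action of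
   GL and the permutations of factors all send a sum of five pure tensors to a
   sum of five pure tensors, where f vanishes.  All the polynomials obtained are
   homogeneous, so their vanishing passes to the closure. *)

From HB Require Import structures.
Require Import Defs.
From mathcomp Require Import all_boot all_order all_algebra all_fingroup.
From Stdlib Require Import FunctionalExtensionality.

Set Implicit Arguments.
Unset Strict Implicit.
Unset Printing Implicit Defensive.

Import GRing.Theory.
Local Open Scope ring_scope.

(** * Expansion of products of sums, and permanents *)

Lemma bigA_distr_dffun (R : comNzRingType) (I : finType) (T : I -> finType)
    (F : forall i, T i -> R) :
  \prod_i \sum_(x : T i) F i x =
  \sum_(f : {dffun forall i, T i}) \prod_i F i (f i).
Proof.
rewrite (reindex (@dffun_of_fprod I T)); last first.
  by exists (@fprod_of_dffun I T) => f _;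
    [apply: dffun_of_fprodK | apply: fprod_of_dffunK].
pose G i := [ffun x => F i x].
transitivity (\prod_i \sum_(x : T i) G i x).
  by apply: eq_bigr => i _; apply: eq_bigr => x _; rewrite ffunE.
(* The inner sums are moved to the single type of tagged pairs, where distributivity for
   non-dependent functions applies. *)
under eq_bigr => i _ do rewrite (big_tag (fun i => G i)).
rewrite bigA_distr_big_dep -(big_fprod _ _ G).
by apply: eq_bigr => f _; apply: eq_bigr => i _; rewrite !ffunE.
Qed.

(* Ryser's formula, the sign being (-1)^(#|I| - #|S|). *)
Lemma permanent_ryser (R : comNzRingType) (I : finType) (M : I -> I -> R) :
  \sum_(p : {perm I}) \prod_j M (p j) j =
  \sum_(S : {set I}) (\prod_i (if i \in S then 1 else -1)) *
    \prod_j \sum_(i in S) M i j.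
Proof.
transitivity (\sum_(f : {ffun I -> I}) (\prod_j M (f j) j) * (injectiveb f)%:R).
  rewrite [RHS](bigID (fun f : {ffun I -> I} => injectiveb f)) /=.
  rewrite [X in _ = _ + X]big1 ?addr0; last first.
    by move=> f /negbTE ->; rewrite mulr0.
  rewrite [RHS](reindex (@pval _)) /=; last first.
    pose in_Sn := insubd (1%g : {perm I}).
    by exists in_Sn => /= f Uf; first apply: val_inj; apply: insubdK.
  apply: eq_big => [p|p _] /=; first by rewrite (valP p).
  by rewrite (valP p) mulr1; apply: eq_bigr => j _; rewrite pvalE.
have expand S : \prod_j \sum_(i in S) M i j =
    \sum_(f : {ffun I -> I}) \prod_j (if f j \in S then M (f j) j else 0).
  rewrite -(bigA_distr_bigA (fun j i => if i \in S then M i j else 0)).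
  by apply: eq_bigr => j _; rewrite big_mkcond.
under [RHS]eq_bigr => S _ do rewrite expand big_distrr /=.
rewrite [RHS]exchange_big; apply: eq_bigr => f _ /=.
(* For fixed [f] only the sets [S] containing its image contribute. Their signs sum to a product
   over [i], with factor 1 + 0 on the image and 1 - 1 off it. This is 1 if [f] is onto, that is
   injective as [I] is finite, and 0 otherwise. *)
transitivity (\sum_(S : {set I}) (\prod_j M (f j) j) *
   \prod_i (if i \in S then 1 else if i \in codom f then 0 else -1)).
  rewrite -big_distrr -bigA_distr; congr (_ * _).
  have [/injectiveP f_inj|f_ninj] := boolP (injectiveb f).
    rewrite big1 // => i _; have /codomP [j ->]: i \in codom f.
      by rewrite -(f_invF f_inj i) codom_f.
    by rewrite codom_f /= addr0.
  have /existsP [i ni] : [exists i, i \notin codom f].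
    rewrite -negb_forall; apply: contraNN f_ninj => /forallP onto.
    have /image_injP f_inj : #|codom f| == #|I| by apply/eqP/eq_card.
    by apply/injectiveP => x y; apply: f_inj.
  by rewrite (bigD1 i) //= (negbTE ni) subrr mul0r.
apply: eq_bigr => S _.
have [fS|] := boolP [forall j, f j \in S].
  rewrite mulrC; congr (_ * _).
    apply: eq_bigr => i _; case: ifPn => // iS; case: ifP => // /codomP [j ij].
    by move/forallP: fS => /(_ j); rewrite -ij (negbTE iS).
  by apply: eq_bigr => j _; move/forallP: fS => /(_ j) ->.
rewrite negb_forall => /existsP [j fj].
rewrite [X in _ * X = _](bigD1 (f j)) //= (negbTE fj) codom_f mul0r mulr0.
by rewrite [X in _ = _ * X](bigD1 j) //= (negbTE fj) mul0r mulr0.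
Qed.

(** * Sums of pure tensors under linear maps and reindexing *)

Lemma tmap_pure (k : fieldType) n (d e : 'I_n -> nat)
    (A : forall i, 'M[k]_(d i, e i)) (v : forall i, 'rV[k]_(d i)) :
  tmap A (pure v) = pure (fun i => v i *m A i).
Proof.
apply/ffunP => J; rewrite !ffunE.
under [RHS]eq_bigr => i _ do rewrite mxE.
rewrite (bigA_distr_dffun (fun i x => v i ord0 x * A i x (J i))).
by apply: eq_bigr => I _; rewrite ffunE big_split.
Qed.

Lemma tensorZE (k : fieldType) n (d : 'I_n -> nat) (c : k) (t : tensor k d) I :
  (c *: t) I = c * t I.
Proof. by rewrite ffunE. Qed.

Lemma tmap_is_linear (k : fieldType) n (d e : 'I_n -> nat)
    (A : forall i, 'M[k]_(d i, e i)) :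
  linear (tmap A : tensor k d -> tensor k e).
Proof.
move=> c t u; apply/ffunP => J; rewrite !ffunE scaler_sumr -big_split /=.
by apply: eq_bigr => I _; rewrite !ffunE mulrDl scalerAl.
Qed.

HB.instance Definition _ (k : fieldType) n (d e : 'I_n -> nat)
    (A : forall i, 'M[k]_(d i, e i)) :=
  GRing.isLinear.Build k (tensor k d) (tensor k e) *:%R (tmap A)
    (tmap_is_linear A).

(** Zero vectors are allowed, unlike in [segre], so that the set is stable under [tmap] even for
    singular matrices. *)
Definition sum_of_pure (k : fieldType) n (r : nat) (d : 'I_n -> nat)
    (t : tensor k d) : Prop :=
  exists (c : 'I_r -> k) (v : 'I_r -> forall i, 'rV[k]_(d i)),
    t = \sum_j c j *: pure (v j).

Lemma sum_of_pure_tmap (k : fieldType) n r (d e : 'I_n -> nat)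
    (A : forall i, 'M[k]_(d i, e i)) (t : tensor k d) :
  sum_of_pure r t -> sum_of_pure r (tmap A t).
Proof.
case=> c [v ->]; exists c, (fun j i => v j i *m A i).
by rewrite linear_sum; apply: eq_bigr => j _; rewrite linearZ /= tmap_pure.
Qed.

(** Serves both for permuting and for grouping factors: reindexing coordinates is linear, so only
    pure tensors need checking. *)
Lemma sum_of_pure_reindex (k : fieldType) n m r (d : 'I_n -> nat)
    (e : 'I_m -> nat) (phi : tidx e -> tidx d) (t : tensor k d)
    (w : (forall i, 'rV[k]_(d i)) -> forall i, 'rV[k]_(e i)) :
  (forall v J, pure v (phi J) = pure (w v) J) ->
  sum_of_pure r t -> sum_of_pure r ([ffun J => t (phi J)] : tensor k e).
Proof.
move=> phi_pure [c [v ->]]; exists c, (fun j => w (v j)).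
apply/ffunP => J; rewrite ffunE !sum_ffunE; apply: eq_bigr => j _.
by rewrite !tensorZE phi_pure.
Qed.

(** * Evaluation and homogeneity of substituted polynomials *)

Lemma peval_psubst (k : fieldType) n m (d : 'I_n -> nat) (e : 'I_m -> nat)
    (X : tidx d -> tpoly k e) (p : tpoly k d) (t : tensor k e) :
  peval (psubst X p) t = peval p [ffun I => peval (X I) t].
Proof.
rewrite /peval /psubst comp_mpoly_meval; apply: meval_eq => x.
by rewrite tnth_mktuple ffunE.
Qed.

Lemma peval_tvar (k : fieldType) n (d : 'I_n -> nat) (I : tidx d)
    (t : tensor k d) : peval (tvar k I) t = t I.
Proof. by rewrite /peval mevalXU enum_rankK. Qed.

Lemma peval_pull (k : fieldType) n (d e : 'I_n -> nat)
    (A : forall i, 'M[k]_(d i, e i)) (p : tpoly k e) (t : tensor k d) :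
  peval (pull A p) t = peval p (tmap A t).
Proof.
rewrite peval_psubst; congr peval; apply/ffunP => J; rewrite !ffunE.
rewrite /peval raddf_sum; apply: eq_bigr => I _ /=.
by rewrite mevalZ [X in _ * X]peval_tvar mulrC.
Qed.

Lemma peval_sum (k : fieldType) n (d : 'I_n -> nat) (T : finType) (c : T -> k)
    (p : T -> tpoly k d) (t : tensor k d) :
  peval (\sum_x c x *: p x) t = \sum_x c x * peval (p x) t.
Proof.
by rewrite /peval raddf_sum; apply: eq_bigr => x _ /=; rewrite mevalZ.
Qed.

Lemma dhomog_psubst (k : fieldType) n m (d : 'I_n -> nat) (e : 'I_m -> nat)
    (X : tidx d -> tpoly k e) (p : tpoly k d) N :
  (forall I, X I \is 1.-homog) -> p \is N.-homog -> psubst X p \is N.-homog.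
Proof.
move=> X1 /dhomogP pN; rewrite /psubst comp_mpolyE big_seq.
apply: rpred_sum => mon /pN monN; apply: dhomogZ.
rewrite -monN /= mdegE; elim/big_rec2: _ => [|i N' q _ qN'].
  exact: dhomog1.
apply: dhomogM => //; rewrite tnth_mktuple -[X in X.-homog]mul1n.
exact: dhomogMn.
Qed.

Lemma dhomog_tvar (k : fieldType) n (d : 'I_n -> nat) (I : tidx d) :
  tvar k I \is 1.-homog.
Proof. by rewrite dhomogX /= mdeg1. Qed.

Lemma dhomog_pull (k : fieldType) n (d e : 'I_n -> nat)
    (A : forall i, 'M[k]_(d i, e i)) (p : tpoly k e) N :
  p \is N.-homog -> pull A p \is N.-homog.
Proof.
apply: dhomog_psubst => J; apply: rpred_sum => I _.
exact/dhomogZ/dhomog_tvar.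
Qed.

(** A sum of pure tensors may be zero, which represents no projective point; a form of positive
    degree has no constant term, so it vanishes there too. *)
Lemma peval0_dhomog (k : fieldType) n (d : 'I_n -> nat) (p : tpoly k d) N :
  p \is N.+1.-homog -> peval p 0 = 0.
Proof.
move=> /dhomogP pN; rewrite /peval mevalE big_seq big1 // => mon /pN monN.
have [i mon_i] : exists i, mon i != 0%N.
  apply/existsP; rewrite -negb_forall; apply/negP => /forallP mon0.
  by move: monN; rewrite /= mdegE big1 // => i _; apply/eqP.
by rewrite (bigD1 i) //= ffunE expr0n (negbTE mon_i) mul0r mulr0.
Qed.

(** * Permuting and grouping tensor factors *)

Lemma sum_of_pure_gl_perm (k : fieldType) n r (d e : 'I_n -> nat) (s : 'S_n)
    (de : forall i, d (s i) = e i) (t : tensor k e) :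
  sum_of_pure r t ->
  sum_of_pure r ([ffun I : tidx d =>
    t [ffun i => cast_ord (de i) (I (s i))]] : tensor k d).
Proof.
(* Reading coordinates through nat avoids transporting [v i] along [de]. *)
pose coef (v : forall i, 'rV[k]_(e i)) i (x : nat) : k :=
  if insub x is Some y then v i ord0 y else 0.
apply: (@sum_of_pure_reindex k n n r e d
  (fun I => [ffun i => cast_ord (de i) (I (s i))])
  t (fun v i => \row_x coef v ((s^-1)%g i) x)) => v I.
rewrite !ffunE [RHS](reindex_inj (@perm_inj _ s)).
apply: eq_bigr => i _; rewrite mxE permK ffunE /coef.
have Is_lt : (I (s i) < e i)%N by have := ltn_ord (I (s i)); rewrite {2}de.
by rewrite insubT; congr (v i ord0 _); apply: val_inj.
Qed.

(** A pure tensor stays pure after grouping: its factor in W_a is the tensor product of the v_i with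
    [pi i = a]. *)
Lemma sum_of_pure_ungroup (k : fieldType) n q r (d : 'I_n -> nat)
    (pi : 'I_n -> 'I_q) (t : tensor k d) :
  sum_of_pure r t ->
  sum_of_pure r ([ffun K => t (ungroup_idx K)] : tensor k (group_dim d pi)).
Proof.
apply: (@sum_of_pure_reindex k n q r d _ (@ungroup_idx n q d pi) t
  (fun v a => \row_x \prod_(i : {i : 'I_n | pi i == a})
     v (val i) ord0 ((enum_val x : group_idx d pi a) i))) => v K.
rewrite !ffunE (partition_big pi predT) //=; apply: eq_bigr => a _.
rewrite mxE.
rewrite (reindex_omap (val : {i : 'I_n | pi i == a} -> 'I_n) insub); last first.
  by move=> i pia; rewrite insubT.
apply: eq_big => [[i pia]|[i pia] _] /=; first by rewrite pia insubT /= eqxx.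
(* Replacing [a] by [pi i] leaves a proof of [pi i == pi i], to be identified with the [eqxx] in
   [ungroup_idx]. *)
rewrite ffunE; case/eqP: _ / (pia) (pia) => pia'.
by rewrite (bool_irrelevance pia' (eqxx (pi i))).
Qed.

(** * Young symmetrizers and functoriality of Schur functors *)

Lemma place_perm_is_linear (k : fieldType) N m (s : 'S_N) :
  linear (@place_perm k N m s).
Proof. by move=> c t u; apply/ffunP => I; rewrite !ffunE. Qed.

HB.instance Definition _ (k : fieldType) N m (s : 'S_N) :=
  GRing.isLinear.Build k (tpower k N m) (tpower k N m) *:%R (place_perm s)
    (@place_perm_is_linear k N m s).

(** The two factors of the Young symmetrizer are separated because polarization concerns only this
    one. *)
Definition row_symmetrizer (k : fieldType) (la : seq nat) m
    (t : tpower k (sumn la) m) : tpower k (sumn la) m :=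
  \sum_(p in row_stab la) place_perm p t.

Lemma row_symmetrizer_is_linear (k : fieldType) la m :
  linear (@row_symmetrizer k la m).
Proof.
move=> c t u; rewrite scaler_sumr -big_split; apply: eq_bigr => p _.
by rewrite linearP.
Qed.

HB.instance Definition _ (k : fieldType) la m :=
  GRing.isLinear.Build k (tpower k (sumn la) m) (tpower k (sumn la) m) *:%R
    (@row_symmetrizer k la m) (@row_symmetrizer_is_linear k la m).

Definition col_antisymmetrizer (k : fieldType) (la : seq nat) m
    (t : tpower k (sumn la) m) : tpower k (sumn la) m :=
  \sum_(q in col_stab la) (-1) ^+ odd_perm q *: place_perm q t.

Lemma col_antisymmetrizer_is_linear (k : fieldType) la m :
  linear (@col_antisymmetrizer k la m).
Proof.
move=> c t u; rewrite scaler_sumr -big_split; apply: eq_bigr => q _.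
by rewrite linearP scalerDr !scalerA mulrC.
Qed.

HB.instance Definition _ (k : fieldType) la m :=
  GRing.isLinear.Build k (tpower k (sumn la) m) (tpower k (sumn la) m) *:%R
    (@col_antisymmetrizer k la m) (@col_antisymmetrizer_is_linear k la m).

Lemma young_symmetrizerE (k : fieldType) (la : seq nat) m
    (t : tpower k (sumn la) m) :
  young_symmetrizer t = col_antisymmetrizer (row_symmetrizer t).
Proof. by []. Qed.

(** The same matrix acts at every place, hence commutes with permutations of places; this makes
    [schur] functorial. *)
Lemma tmap_place_perm (k : fieldType) N m m' (h : 'M[k]_(m, m')) (s : 'S_N)
    (t : tpower k N m) :
  tmap (fun _ => h) (place_perm s t) = place_perm s (tmap (fun _ => h) t).
Proof.
apply/ffunP => J; rewrite !ffunE.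
rewrite (reindex (fun I : tidx (fun _ : 'I_N => m) =>
    [ffun j => I (s j)] : tidx (fun _ : 'I_N => m))) /=; last first.
  exists (fun I => [ffun j => I ((s^-1)%g j)]) => I _; apply/ffunP => j;
    by rewrite !ffunE ?permK ?permKV.
apply: eq_bigr => I _; rewrite ffunE; congr (t _ * _).
  by apply/ffunP => j; rewrite !ffunE permKV.
rewrite [RHS](reindex_inj (@perm_inj _ s)); apply: eq_bigr => j _.
by rewrite !ffunE permK.
Qed.

Lemma tmap_row_symmetrizer (k : fieldType) (la : seq nat) m m'
    (h : 'M[k]_(m, m')) (t : tpower k (sumn la) m) :
  tmap (fun _ => h) (row_symmetrizer t) =
  row_symmetrizer (tmap (fun _ => h) t).
Proof.
by rewrite linear_sum; apply: eq_bigr => p _; rewrite -tmap_place_perm.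
Qed.

Lemma tmap_col_antisymmetrizer (k : fieldType) (la : seq nat) m m'
    (h : 'M[k]_(m, m')) (t : tpower k (sumn la) m) :
  tmap (fun _ => h) (col_antisymmetrizer t) =
  col_antisymmetrizer (tmap (fun _ => h) t).
Proof.
rewrite linear_sum; apply: eq_bigr => q _.
by rewrite linearZ /= -tmap_place_perm.
Qed.

Lemma schur_tmap (k : fieldType) la m m' (h : 'M[k]_(m, m'))
    (t : tpower k (sumn la) m) : schur t -> schur (tmap (fun _ => h) t).
Proof.
case=> u ->; exists (tmap (fun _ => h) u).
by rewrite !young_symmetrizerE tmap_col_antisymmetrizer tmap_row_symmetrizer.
Qed.

Lemma schur_linear (k : fieldType) la m (c : k) (t u : tpower k (sumn la) m) :
  schur t -> schur u -> schur (c *: t + u).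
Proof.
case=> [t' ->] [u' ->]; exists (c *: t' + u').
by rewrite !young_symmetrizerE !linearP.
Qed.

Lemma schur0 (k : fieldType) la m : schur (0 : tpower k (sumn la) m).
Proof. by exists 0; rewrite young_symmetrizerE !linear0. Qed.

(** * Polarization: one tensor generates the Schur functor *)

Definition row_word (la : seq nat) : tidx (fun _ : 'I_(sumn la) => size la) :=
  [ffun j => Ordinal (reshape_indexP (ltn_ord j))].

Lemma mem_row_stab la (p : 'S_(sumn la)) :
  (p \in row_stab la) = [forall j, row_word la (p j) == row_word la j].
Proof. by rewrite inE; apply: eq_forallb => j; rewrite !ffunE. Qed.

(** With the e_i the basis vectors, this is the tensor product of la_1 copies of e_1, then la_2
    copies of e_2, and so on. *)
Definition row_tensor (k : fieldType) (la : seq nat) :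
    tpower k (sumn la) (size la) :=
  [ffun I => (I == row_word la)%:R].

Lemma tmap_row_tensor (k : fieldType) la m (h : 'M[k]_(size la, m))
    (J : tidx (fun _ : 'I_(sumn la) => m)) :
  tmap (fun _ => h) (row_tensor k la) J = \prod_j h (row_word la j) (J j).
Proof.
rewrite ffunE (bigD1 (row_word la)) //= ffunE eqxx mul1r.
rewrite [X in _ + X]big1 ?addr0 //.
by move=> I /negbTE IR; rewrite ffunE IR mul0r.
Qed.

Lemma row_symmetrizer_row_tensor (k : fieldType) la :
  row_symmetrizer (row_tensor k la) = #|row_stab la|%:R *: row_tensor k la.
Proof.
rewrite /row_symmetrizer -sumr_const scaler_suml; apply: eq_bigr => p.
rewrite mem_row_stab => /forallP pR; rewrite scale1r; apply/ffunP => I.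
rewrite !ffunE; congr (_%:R); congr nat_of_bool.
apply/eqP/eqP => IR; apply/ffunP => j.
  by move/ffunP/(_ (p j)): IR; rewrite ffunE permK (eqP (pR j)).
by rewrite ffunE IR -{2}(permKV p j) (eqP (pR _)).
Qed.

(* Polarization: the row symmetrization of a basis tensor is a signed sum of
   tensors whose factors are equal along each row. *)
Lemma row_symmetrizer_span (k : fieldType) la m (u : tpower k (sumn la) m) :
  exists (c : tidx (fun _ : 'I_(sumn la) => m) * {set 'I_(sumn la)} -> k)
      (h : _ -> 'M[k]_(size la, m)),
    row_symmetrizer u =
    \sum_x c x *: tmap (fun _ => h x) (row_tensor k la).
Proof.
pose R := row_word la.
pose sgn (S : {set 'I_(sumn la)}) : k := \prod_i (if i \in S then 1 else -1).
pose X := (tidx (fun _ : 'I_(sumn la) => m) * {set 'I_(sumn la)})%type.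
(* For a word [I] and a set [S] of boxes, row [a] of the matrix is the sum of e_(I i) over the boxes
   [i] of [S] in row [a]. The signs are those of Ryser's formula. *)
exists (fun x => (u x.1 : k) * sgn x.2), (fun x : X =>
  \matrix_(a, b) \sum_(i in x.2) ((R i == a) && (x.1 i == b))%:R).
apply/ffunP => J; rewrite !sum_ffunE.
(* The permanent of [M I] is the coefficient at [J] of the row symmetrization of the basis tensor
   e_I; the condition on rows discards permutations outside [row_stab la]. *)
pose M (I : tidx (fun _ : 'I_(sumn la) => m)) i j : k :=
  ((R i == R j) && (I i == J j))%:R.
transitivity (\sum_I u I * \sum_(p : 'S_(sumn la)) \prod_j M I (p j) j).
  under [RHS]eq_bigr => I _ do rewrite big_distrr /=.
  rewrite [RHS]exchange_big /= big_mkcond /=; apply: eq_bigr => p _.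
  case: ifPn; rewrite mem_row_stab.
    move=> /forallP pR; rewrite ffunE.
    rewrite [RHS](bigD1 [ffun j => J ((p^-1)%g j)]) //=.
    rewrite [X in _ + X]big1 ?addr0 => [|I IJ].
      by rewrite big1 ?mulr1 // => j _;
        rewrite /M (eqP (pR j)) eqxx /= ffunE permK eqxx.
    have /existsP [j IjJ] : [exists j, I (p j) != J j].
      rewrite -negb_forall; apply: contraNN IJ => /forallP IJ.
      by apply/eqP/ffunP => j; rewrite ffunE -(eqP (IJ _)) permKV.
    by rewrite (bigD1 j) //= /M (negbTE IjJ) andbF mul0r mulr0.
  rewrite negb_forall => /existsP [j pj]; rewrite big1 // => I _.
  by rewrite (bigD1 j) //= /M (negbTE pj) mul0r mulr0.
rewrite [RHS](eq_bigr (fun x => u x.1 * (sgn x.2 *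
    \prod_j \sum_(i in x.2) M x.1 i j))); last first.
  move=> x _; rewrite tensorZE tmap_row_tensor mulrA; congr (_ * _).
  by apply: eq_bigr => j _; rewrite mxE.
rewrite -(pair_bigA _ (fun I S => u I * (sgn S *
    \prod_j \sum_(i in S) M I i j))) /=.
by apply: eq_bigr => I _; rewrite permanent_ryser big_distrr.
Qed.

(** For a partition [la] in characteristic 0, this is a highest weight vector of S_la. *)
Definition schur_generator (k : fieldType) la : tpower k (sumn la) (size la) :=
  col_antisymmetrizer (row_tensor k la).

(** Characteristic 0 enters here: the row symmetrizer multiplies [row_tensor] by the order of
    [row_stab], which has to be inverted. *)
Lemma schur_schur_generator (k : fieldType) (char0 : [pchar k] =i pred0) la :
  schur (schur_generator k la).
Proof.
have R0 : #|row_stab la|%:R != 0 :> k.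
  rewrite (pcharf0P k).1 // -lt0n; apply/card_gt0P; exists 1%g.
  by rewrite mem_row_stab; apply/forallP => j; rewrite perm1.
exists (#|row_stab la|%:R^-1 *: row_tensor k la).
rewrite young_symmetrizerE linearZ /= row_symmetrizer_row_tensor.
by rewrite scalerA mulVf ?scale1r.
Qed.

Lemma schur_span (k : fieldType) la m (t : tpower k (sumn la) m) :
  schur t -> exists (T : finType) (c : T -> k) (h : T -> 'M[k]_(size la, m)),
    t = \sum_x c x *: tmap (fun _ => h x) (schur_generator k la).
Proof.
case=> u ->; rewrite young_symmetrizerE.
have [c [h ->]] := row_symmetrizer_span u; exists _, c, h.
rewrite linear_sum; apply: eq_bigr => x _.
by rewrite linearZ /= tmap_col_antisymmetrizer.
Qed.

(** * Natural transformations and inheritance *)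

Lemma dfwith_id (I : eqType) (T : I -> Type) (f : forall i, T i) i :
  dfwith f (f i) = f.
Proof. by apply: functional_extensionality_dep => j; case: dfwithP. Qed.

(** By multilinearity and [schur_span], each slot can be reduced to images of the generator, with an
    independent matrix per slot. *)
Lemma schur_transformation_eq0 (k : fieldType) (char0 : [pchar k] =i pred0)
    r la Phi (m : 'I_r -> nat) (t : tensor k m) :
  schur_transformation Phi ->
  (forall h : forall i, 'M[k]_(size la, m i),
     peval (Phi m (fun i => tmap (fun _ => h i) (schur_generator k la))) t
     = 0) ->
  forall s : forall i, tpower k (sumn la) (m i),
    (forall i, schur (s i)) -> peval (Phi m s) t = 0.
Proof.
case=> _ Phi_lin _ Phi0.
have schur_img m' (h : 'M_(_, m')) :
    schur (tmap (fun _ => h) (schur_generator k la)).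
  exact/schur_tmap/schur_schur_generator.
(* The slots from the j-th on are already images of the generator; those
   before it are expanded one at a time. *)
suff step j : (j <= r)%N -> forall s : forall i, tpower k (sumn la) (m i),
    (forall i, schur (s i)) ->
    (forall i : 'I_r, (j <= i)%N ->
       exists h : 'M_(size la, m i),
         s i = tmap (fun _ => h) (schur_generator k la)) ->
    peval (Phi m s) t = 0.
  move=> s schur_s; apply: (step r) => // i.
  by rewrite leqNgt ltn_ord.
elim: j => [_ s _ sE|j IHj lt_jr s schur_s sE].
  have [h sh] := fin_all_exists (fun i => sE i (leq0n i)).
  by rewrite (functional_extensionality_dep _ _ sh).
pose i0 := Ordinal lt_jr.
have [T [c [h si0]]] := schur_span (schur_s i0).
have schur_with (u : tpower k (sumn la) (m i0)) :
    schur u -> forall i, schur (dfwith s u i).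
  by move=> schur_u i; case: dfwithP.
have Phi_with0 : Phi m (dfwith s (0 : tpower k (sumn la) (m i0))) = 0.
  have := Phi_lin m s i0 1 0 0 schur_s (schur0 _ _ _) (schur0 _ _ _).
  rewrite !scale1r addr0 => /eqP.
  by rewrite -subr_eq0 opprD addNKr oppr_eq0 => /eqP.
rewrite -(dfwith_id s i0) si0.
set S := \sum_x _.
(* Linearity of [Phi] is available on [schur] only, so membership of the partial sums is carried
   through the induction. *)
suff [] : schur S /\ peval (Phi m (dfwith s S)) t = 0 by [].
rewrite {}/S; elim: (index_enum T) => [|x l [schur_l Phi_l]].
  by rewrite !big_nil Phi_with0; split; [apply: schur0 | rewrite /peval meval0].
rewrite !big_cons; split; first exact: schur_linear.
rewrite Phi_lin // /peval mevalD mevalZ [X in _ + X]Phi_l addr0.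
rewrite [X in _ * X]IHj ?mulr0 //; first exact: ltnW.
- exact: schur_with.
move=> i; case: dfwithP => [_|i' ne_i' le_ji']; first by exists (h x).
by apply: sE; rewrite ltn_neqAle le_ji' andbT.
Qed.

Lemma schur_image_dhomog (k : fieldType) r la Phi (m : 'I_r -> nat)
    (F : tpoly k m) :
  schur_transformation Phi -> @schur_image k r la Phi m F ->
  F \is (sumn la).-homog.
Proof.
case=> PhiN _ _ [N [c [p [pP ->]]]]; apply: rpred_sum => i _.
by have [s [schur_s ->]] := pP i; apply/dhomogZ/PhiN.
Qed.

(** Two rows make the generator live over k^2, where [Phi] takes values in the multiples of [f];
    naturality turns the other values needed into pullbacks. *)
Lemma inherits_eq0 (k : fieldType) (char0 : [pchar k] =i pred0) r a b q
    (f : tpoly k (fun _ : 'I_r => 2%N)) (m : 'I_r -> nat) (F : tpoly k m) :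
  (forall t, sum_of_pure q t -> peval f t = 0) -> inherits [:: a; b] f F ->
  forall t, sum_of_pure q t -> peval F t = 0.
Proof.
move=> f0 [Phi [PhiT PhiE [N [c [p [pP ->]]]]]] t qt.
rewrite peval_sum big1 // => i _; have [s [schur_s ->]] := pP i.
rewrite (schur_transformation_eq0 char0 PhiT _ schur_s) ?mulr0 // => h.
pose gen (_ : 'I_r) := schur_generator k [:: a; b].
have schur_gen i' : schur (gen i') by apply: schur_schur_generator.
have [_ _ Phi_nat] := PhiT; rewrite (Phi_nat _ _ h gen schur_gen) peval_pull.
have /PhiE [c' ->] : schur_image Phi (Phi _ gen).
  exists 1%N, (fun _ => 1), (fun _ => Phi _ gen).
  by rewrite big_ord1 scale1r; split=> // _; exists gen.
by rewrite /peval mevalZ [X in _ * X]f0 ?mulr0 //; apply: sum_of_pure_tmap.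
Qed.

(** * Natural liftings and their orbits *)

Lemma natural_lifting_dhomog (k : fieldType) n r la
    (f : tpoly k (fun _ : 'I_r => 2%N)) (d : 'I_n -> nat) (F : tpoly k d) :
  natural_lifting la f F -> F \is (sumn la).-homog.
Proof.
case=> pi [_ [G [[Phi [PhiT _ GP]] ->]]]; apply: dhomog_psubst.
  by move=> K; apply: dhomog_tvar.
exact: schur_image_dhomog GP.
Qed.

Lemma natural_lifting_eq0 (k : fieldType) (char0 : [pchar k] =i pred0) n r a b q
    (f : tpoly k (fun _ : 'I_r => 2%N)) (d : 'I_n -> nat) (F : tpoly k d) :
  (forall t, sum_of_pure q t -> peval f t = 0) ->
  natural_lifting [:: a; b] f F ->
  forall t, sum_of_pure q t -> peval F t = 0.
Proof.
move=> f0 [pi [_ [G [GP ->]]]] t qt; rewrite peval_psubst.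
apply: (inherits_eq0 char0 f0 GP).
suff -> : [ffun K => peval (tvar k (ungroup_idx K)) t] =
    [ffun K => t (ungroup_idx K)] :> tensor k (group_dim d pi).
  exact: sum_of_pure_ungroup.
by apply/ffunP => K; rewrite !ffunE peval_tvar.
Qed.

Lemma orbit_elt_dhomog (k : fieldType) n (d e : 'I_n -> nat) N (p : tpoly k d)
    (q : tpoly k e) : orbit_elt p q -> p \is N.-homog -> q \is N.-homog.
Proof.
case=> s [de [g [_ ->]]] pN; apply/dhomog_pull/dhomog_psubst => // I.
exact: dhomog_tvar.
Qed.

Lemma orbit_elt_eq0 (k : fieldType) n (d e : 'I_n -> nat) r (p : tpoly k d)
    (q : tpoly k e) :
  orbit_elt p q -> (forall t, sum_of_pure r t -> peval p t = 0) ->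
  forall t, sum_of_pure r t -> peval q t = 0.
Proof.
case=> s [de [g [_ ->]]] p0 t rt; rewrite peval_pull peval_psubst.
set u := tmap _ t; have ru : sum_of_pure r u by apply: sum_of_pure_tmap.
apply: p0.
pose phi (I : tidx d) : tidx e := [ffun i => cast_ord (de i) (I (s i))].
suff -> : [ffun I => peval (tvar k (phi I)) u] = [ffun I => u (phi I)]
    :> tensor k d.
  exact: sum_of_pure_gl_perm.
by apply/ffunP => I; rewrite [RHS]ffunE [LHS]ffunE peval_tvar.
Qed.

(** * Secant varieties versus sums of pure tensors *)

Lemma secant_span_sum_of_pure (k : fieldType) n r (d : 'I_n -> nat)
    (x : r.-tuple (tensor k d)) (t : tensor k d) :
  (forall j, segre (tnth x j)) -> t \in <<x>>%VS -> sum_of_pure r t.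
Proof.
move=> /fin_all_exists [v vP] /coord_span tE.
exists (fun j => coord x j t), v; rewrite {1}tE; apply: eq_bigr => j _.
by rewrite -tnth_nth (vP j).2.
Qed.

(** Homogeneity is required because [zariski_closure] is tested on forms only. *)
Lemma dhomog_vanishes_on_secant (k : fieldType) n r (d : 'I_n -> nat) N
    (p : tpoly k d) :
  p \is N.-homog -> (forall t, sum_of_pure r t -> peval p t = 0) ->
  vanishes_on (secant_variety r (@segre k n d)) p.
Proof.
move=> pN p0 t [_]; apply; first exact: pN.
by move=> y [_ [x [xP yx]]]; apply: p0; apply: secant_span_sum_of_pure yx.
Qed.

(** Applied to [f6] and [f16]. Positive dimensions provide a Segre point with which to fill the
    slots of zero pure tensors. *)
Lemma vanishes_on_secant_eq0 (k : fieldType) n r N (d : 'I_n -> nat)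
    (d_gt0 : forall i, (0 < d i)%N) (p : tpoly k d) :
  p \is N.+1.-homog -> vanishes_on (secant_variety r (@segre k n d)) p ->
  forall t, sum_of_pure r t -> peval p t = 0.
Proof.
move=> pN p0 t [c [v tE]].
have [->|t0] := eqVneq t 0; first exact: peval0_dhomog pN.
apply: p0; split=> // N' p' _; apply; split=> //.
pose one : tensor k d := pure (fun i => const_mx 1).
(* A zero pure tensor is not a point of the Segre variety. *)
exists [tuple if pure (v j) == 0 then one else pure (v j) | j < r].
split=> [j|].
  rewrite tnth_mktuple; case: eqVneq => [_|vj].
    exists (fun i => const_mx 1); split=> // i.
    apply/eqP => /rowP/(_ (Ordinal (d_gt0 i))); rewrite !mxE.
    by apply/eqP; apply: oner_neq0.
  exists (v j); split=> // i; apply: contraNneq vj => vji.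
  by apply/eqP/ffunP => I; rewrite !ffunE (bigD1 i) //= vji mxE mul0r.
rewrite tE; apply: memv_suml => j _; have [->|vj] := eqVneq (pure (v j)) 0.
  by rewrite scaler0 mem0v.
apply/memvZ/memv_span; apply/tnthP; exists j.
by rewrite tnth_mktuple (negbTE vj).
Qed.

Theorem mainTheorem2 (k : fieldType) (char0 : [pchar k] =i pred0)
    (n : nat) (n_ge5 : (5 <= n)%N) (d : 'I_n -> nat)
    (f6 f16 : tpoly k (fun _ : 'I_5 => 2%N))
    (deg_f6 : f6 \is 6.-homog) (deg_f16 : f16 \is 16.-homog)
    (gen_f : minimal_generators
       (vanishes_on (secant_variety 5 (@segre k 5 (fun _ => 2%N))))
       [:: f6; f16])
    (F6 F16 : tpoly k d)
    (lift_F6 : natural_lifting [:: 3; 3]%N f6 F6)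
    (lift_F16 : natural_lifting [:: 8; 8]%N f16 F16) :
  forall (e : 'I_n -> nat) (p : tpoly k e),
    lspan (fun q => orbit_elt F6 q \/ orbit_elt F16 q) p ->
    vanishes_on (secant_variety 5 (@segre k n e)) p.
Proof.
move=> e p [N [c [q [qP ->]]]] t Xt.
have d2_gt0 (i : 'I_5) : (0 < (fun _ : 'I_5 => 2%N) i)%N by [].
have gen_vanish (i : 'I_2) :
    vanishes_on (secant_variety 5 (@segre k 5 (fun _ => 2%N))) [:: f6; f16]`_i.
  (* Each generator lies in the ideal, with Kronecker deltas as coefficients. *)
  apply/gen_f.1; exists (fun j => (i == j)%:R).
  rewrite (bigD1 i) //= eqxx mul1r big1 ?addr0 // => j /negbTE.
  by rewrite eq_sym => ->; rewrite mul0r.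
have f6_0 := vanishes_on_secant_eq0 d2_gt0 deg_f6 (gen_vanish 0).
have f16_0 := vanishes_on_secant_eq0 d2_gt0 deg_f16 (gen_vanish 1).
rewrite peval_sum big1 // => i _; suff -> : peval (q i) t = 0 by rewrite mulr0.
case: (qP i) => qi.
- apply: (dhomog_vanishes_on_secant _ _ Xt).
    exact: orbit_elt_dhomog qi (natural_lifting_dhomog lift_F6).
  exact: orbit_elt_eq0 qi (natural_lifting_eq0 char0 f6_0 lift_F6).
- apply: (dhomog_vanishes_on_secant _ _ Xt).
    exact: orbit_elt_dhomog qi (natural_lifting_dhomog lift_F16).
  exact: orbit_elt_eq0 qi (natural_lifting_eq0 char0 f16_0 lift_F16).
Qed.
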